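(* Let $p$ be a prime number, let $K$ be a global field containing a primitive $p$-th root of unity, and let $a,b,c\in K^\times$. If the triple Massey product $\langle \chi_a,\chi_b,\chi_c\rangle\subseteq H^2(G_K,\mathbb{F}_p)$ is defined, then it contains $0$.
   Context: A global field is a finite extension of $\mathbb{Q}$ or a function field in one variable over a finite field. $G_K$ denotes the absolute Galois group of $K$. A primitive $p$-th root of unity $\zeta_p\in K$ is fixed. For $a\in K^\times$, $\chi_a\in H^1(G_K,\mathbb{F}_p)$ is the corresponding Kummer character: $\sigma(\sqrt[p]{a})=\zeta_p^{\chi_a(\sigma)}\sqrt[p]{a}$ for all $\sigma\in G_K$. Massey products: for a profinite group $G$, let $\mathcal{C}^\bullet=\mathcal{C}^\bullet(G,\mathbb{F}_p)$ be the differential graded algebra of inhomogeneous continuous cochains of $G$ with coefficients in $\mathbb{F}_p$ (trivial action), with cup product $\cup$ and differential $\partial$; its cohomology is $H^\bullet(G,\mathbb{F}_p)$. Let $\alpha_1,\ldots,\alpha_n\in H^1(G,\mathbb{F}_p)$. A defining system for the $n$-fold Massey product $\langle \alpha_1,\ldots,\alpha_n\rangle$ is a collection $\mathcal{M}=(a_{ij})$, $1\le i<j\le n+1$, $(i,j)\ne(1,n+1)$, of elements of $\mathcal{C}^1$ such that (1) $a_{i,i+1}$ represents $\alpha_i$, and (2) $\partial a_{ij}=\sum_{l=i+1}^{j-1}a_{il}\cup a_{lj}$ for $i+1<j$. Then $\sum_{k=2}^{n}a_{1k}\cup a_{k,n+1}$ is a $2$-cocycle, whose class in $H^2(G,\mathbb{F}_p)$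 is denoted $\langle \alpha_1,\ldots,\alpha_n\rangle_{\mathcal{M}}$. The Massey product $\langle \alpha_1,\ldots,\alpha_n\rangle$ is the subset of $H^2(G,\mathbb{F}_p)$ of all classes $\langle \alpha_1,\ldots,\alpha_n\rangle_{\mathcal{M}}$ for $\mathcal{M}$ a defining system; it is defined if it is non-empty (i.e. a defining system exists). For $n=3$ it is called a triple Massey product. *)

(* Defs.v *)
From HB Require Import structures.
From mathcomp Require Import all_boot all_order all_algebra all_field.
From mathcomp Require Import generic_quotient ring_quotient fraction separable.
From mathcomp Require Import ring boolp classical_sets functions cardinality topology.

Set Implicit Arguments.
Unset Strict Implicit.
Unset Printing Implicit Defensive.

Import GRing.Theory.
Local Open Scope classical_set_scope.
Local Open Scope ring_scope.

HB.mixin Record isTopologicalGroup G & Topological G & Group G := {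
  mulg_continuous : continuous (fun x : G * G => (x.1 * x.2)%g);
  invg_continuous : continuous (fun x : G => (x^-1)%g)
}.

#[short(type="topologicalGroupType")]
HB.structure Definition TopologicalGroup :=
  {G of isTopologicalGroup G & Topological G & Group G}.

Section Cochains.
Variables (G : topologicalGroupType) (p : nat).

Lemma continuous_discreteP (T : topologicalType) (D : choiceType) (f : T -> D) :
  continuous (f : T -> discrete_topology D) <->
  (forall x, \forall y \near x, f y = f x).
Proof.
split=> fc x; last by apply/discrete_cvg; exact: fc.
by have /discrete_cvg := fc x; apply.
Qed.

Lemma ptws_continuous (T U : topologicalType) (I : eqType) (h : T -> {ptws I -> U}) :
  (forall i, continuous (fun x => h x i)) -> continuous h.
Proof.
move=> hc x; apply/cvg_sup => i U0 [V [[W] oW <-] /= Wx sWU].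
apply: filterS sWU _; apply: (hc i x); exact: open_nbhs_nbhs.
Qed.

Definition cochain_pred n : {pred ({ptws 'I_n -> G} -> 'F_p)} :=
  fun f => `[< continuous (f : _ -> discrete_topology 'F_p) >].

Lemma cochain_predP n (f : {ptws 'I_n -> G} -> 'F_p) :
  reflect (forall x, \forall y \near x, f y = f x) (f \in @cochain_pred n).
Proof. by apply: (iffP (asboolP _)); rewrite continuous_discreteP. Qed.

Fact cochain_zmod_closed n : zmod_closed (@cochain_pred n).
Proof.
split=> [|f g /cochain_predP fc /cochain_predP gc].
  by apply/cochain_predP => x; near=> y.
apply/cochain_predP => x; near=> y.
have fy : f y = f x by near: y; exact: fc.
have gy : g y = g x by near: y; exact: gc.
by rewrite !fctE fy gy.
Unshelve. all: by end_near. Qed.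

HB.instance Definition _ n :=
  GRing.isZmodClosed.Build _ (@cochain_pred n) (@cochain_zmod_closed n).

Record cochain n := Cochain {
  cochain_fun :> {ptws 'I_n -> G} -> 'F_p;
  cochainP : cochain_fun \in @cochain_pred n }.

HB.instance Definition _ n := [isSub for @cochain_fun n].
HB.instance Definition _ n := [Choice of cochain n by <:].
HB.instance Definition _ n := [SubChoice_isSubZmodule of cochain n by <:].

Lemma cochain_near n (f : cochain n) x : \forall y \near x, f y = f x.
Proof. exact/cochain_predP/cochainP. Qed.

Lemma cochain_comp_near n (T : topologicalType) (h : T -> {ptws 'I_n -> G})
    (f : cochain n) (x : T) :
  (forall i, continuous (fun y => h y i)) -> \forall y \near x, f (h y) = f (h x).
Proof.
move=> /ptws_continuous/(_ x) hc; exact: (hc _ (cochain_near f (h x))).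
Qed.

Lemma cochainD n (f g : cochain n) x : (f + g) x = f x + g x.
Proof. by []. Qed.
Lemma cochainB n (f g : cochain n) x : (f - g) x = f x - g x.
Proof. by []. Qed.
Lemma cochain_sum n I (r : seq I) P (F : I -> cochain n) x :
  (\sum_(i <- r | P i) F i) x = \sum_(i <- r | P i) F i x.
Proof. by apply: (big_morph (fun f : cochain n => f x)). Qed.
Lemma cochain_eq n (f g : cochain n) : (forall x, f x = g x) -> f = g.
Proof. by move=> fg; apply/val_inj/funext. Qed.

(* The [i]-th face of the bar construction on [n.+1] letters: it drops the first letter *)
(* for [i = 0] and the last one for [i = n.+1], and otherwise multiplies the letters of *)
(* positions [i.-1] and [i].                                                            *)
Definition face n (i : nat) (g : {ptws 'I_n.+1 -> G}) : {ptws 'I_n -> G} :=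
  fun j => let g0 := g (widen_ord (leqnSn n) j) in let g1 := g (lift ord0 j) in
    if (j.+1 < i)%N then g0 else if j.+1 == i then (g0 * g1)%g else g1.

Lemma face_continuous n i j : continuous (fun g => @face n i g j).
Proof.
have pc k : continuous (fun g : {ptws 'I_n.+1 -> G} => g k).
  exact: (@proj_continuous _ (fun=> G)).
rewrite /face; case: (j.+1 < i)%N; first exact: pc.
case: (j.+1 == i) => [g|]; last exact: pc.
apply: (@continuous2_cvg _ _ _ _ (nbhs (g : {ptws _ -> _})) (nbhs_filter _) _ _
  (fun x y : G => (x * y)%g)).
- exact: (mulg_continuous (g _, g _)).
- exact: pc.
- exact: pc.
Qed.

Fact differential_subproof n (f : cochain n) :
  (fun g => \sum_(i < n.+2) (-1) ^+ i * f (face i g)) \in @cochain_pred n.+1.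
Proof.
apply/cochain_predP => g.
have fh (i : 'I_n.+2) : \forall h \near g, f (face i h) = f (face i g).
  by apply: cochain_comp_near => j; exact: face_continuous.
have := @filter_forall _ _ _ _ (nbhs_filter g) fh.
by apply: filterS => h {}fh; apply: eq_bigr => i _; rewrite fh.
Qed.

Definition differential n (f : cochain n) : cochain n.+1 :=
  Cochain (differential_subproof f).

Fact differential_is_zmod_morphism n : zmod_morphism (@differential n).
Proof.
move=> f g; apply: cochain_eq => x; rewrite cochainB [RHS]/= -sumrB.
by apply: eq_bigr => i _; rewrite -mulrBr.
Qed.

HB.instance Definition _ n := GRing.isZmodMorphism.Build _ _ (@differential n)
  (@differential_is_zmod_morphism n).

Fact cup_subproof m n (f : cochain m) (h : cochain n) :
  (fun g => f (fun i => g (lshift n i)) * h (fun i => g (rshift m i)))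
    \in @cochain_pred (m + n).
Proof.
apply/cochain_predP => g; near=> x; congr (_ * _).
- near: x; apply: (@cochain_comp_near _ _ (fun g : {ptws 'I_(m + n) -> G} =>
    (fun i => g (lshift n i)) : {ptws 'I_m -> G})) => i.
  exact: (@proj_continuous 'I_(m + n) (fun=> G)).
- near: x; apply: (@cochain_comp_near _ _ (fun g : {ptws 'I_(m + n) -> G} =>
    (fun i => g (rshift m i)) : {ptws 'I_n -> G})) => i.
  exact: (@proj_continuous 'I_(m + n) (fun=> G)).
Unshelve. all: by end_near. Qed.

Definition cup m n (f : cochain m) (h : cochain n) : cochain (m + n) :=
  Cochain (cup_subproof f h).

Definition cocycle_pred n : {pred cochain n} := fun f => differential f == 0.

Fact cocycle_zmod_closed n : zmod_closed (@cocycle_pred n).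
Proof.
split=> [|f g fZ gZ]; apply/eqP; first exact: raddf0.
have fE : differential f = 0 := eqP fZ.
have gE : differential g = 0 := eqP gZ.
by rewrite differential_is_zmod_morphism fE gE subr0.
Qed.
HB.instance Definition _ n :=
  GRing.isZmodClosed.Build _ (@cocycle_pred n) (@cocycle_zmod_closed n).

Record cocycle n := Cocycle {
  cocycle_val :> cochain n;
  cocycleP : cocycle_val \in @cocycle_pred n }.

HB.instance Definition _ n := [isSub for @cocycle_val n].
HB.instance Definition _ n := [Choice of cocycle n by <:].
HB.instance Definition _ n := [SubChoice_isSubZmodule of cocycle n by <:].

Definition coboundary n : {pred cocycle n} :=
  match n with
  | 0 => fun z => z == 0
  | m.+1 => fun z => `[< exists f : cochain m, val z = differential f >]
  end.

Fact coboundary_zmod_closed n : zmod_closed (@coboundary n).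
Proof.
case: n => [|n]; split=> [|x y].
- by rewrite unfold_in.
- by rewrite !unfold_in => /eqP-> /eqP->; rewrite subr0.
- apply/asboolP; exists 0; exact/esym/raddf0.
- move=> /asboolP[f fE] /asboolP[g gE]; apply/asboolP; exists (f - g).
  by rewrite differential_is_zmod_morphism -fE -gE.
Qed.
HB.instance Definition _ n :=
  GRing.isZmodClosed.Build _ (@coboundary n) (@coboundary_zmod_closed n).

Definition cohomology n := Quotient.quot (@coboundary n).
HB.instance Definition _ n := GRing.Zmodule.on (cohomology n).

Definition cohomology_class n (z : cocycle n) : cohomology n :=
  (\pi_(cohomology n) z)%qT.

Definition represents n (f : cochain n) (x : cohomology n) : Prop :=
  exists2 z : cocycle n, val z = f & cohomology_class z = x.

End Cochains.

Section Massey.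
Variables (G : topologicalGroupType) (p : nat).
Local Notation cochain := (cochain G p).
Local Notation cocycle := (cocycle G p).

Fact cohomology_class_is_zmod_morphism n : zmod_morphism (@cohomology_class G p n).
Proof.
have cN : {morph @cohomology_class G p n : x / - x} by exact: pi_oppr.
have cD : {morph @cohomology_class G p n : x y / x + y} by exact: pi_addr.
by move=> x y; rewrite cD cN.
Qed.
HB.instance Definition _ n := GRing.isZmodMorphism.Build _ _
  (@cohomology_class G p n) (@cohomology_class_is_zmod_morphism n).

Lemma cohomology_class_eq0 n (z : cocycle n) :
  (cohomology_class z == 0) = (z \in @coboundary G p n).
Proof.
by rewrite -[z in RHS]subr0 Quotient.idealrBE -(raddf0 (@cohomology_class G p n)).
Qed.

Lemma represents0 n (f : cochain n.+1) :
  represents f 0 <-> f \in @cocycle_pred G p n.+1 /\ exists b, f = differential b.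
Proof.
split=> [[z <- /eqP]|[fz [b fE]]].
  by rewrite cohomology_class_eq0 => /asboolP bz; split=> //; exact: cocycleP.
exists (Cocycle fz) => //; apply/eqP; rewrite cohomology_class_eq0.
by apply/asboolP; exists b.
Qed.

Definition const1 (x : G) : {ptws 'I_1 -> G} := fun=> x.
Definition pair2 (x y : G) : {ptws 'I_2 -> G} := fun j => if j == 0 :> nat then x else y.

Lemma differential1E (f : cochain 1) (g : {ptws 'I_2 -> G}) :
  differential f g = f (const1 (g ord_max)) - f (const1 (g ord0 * g ord_max)%g)
    + f (const1 (g ord0)).
Proof.
rewrite /= !big_ord_recl big_ord0.
rewrite !(expr0, expr1, exprS, mulN1r, mul1r, addr0, opprK, mulrN1).
have e0 : widen_ord (leqnSn 1) ord0 = ord0 by exact/val_inj.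
have e1 : lift ord0 (ord0 : 'I_1) = ord_max by exact/val_inj.
by rewrite addrA; congr (f _ - f _ + f _); apply/funext => j;
  rewrite (ord1 j) /face /= ?e0 ?e1.
Qed.

Lemma differential2E (f : cochain 2) (g : {ptws 'I_3 -> G}) :
  differential f g =
    f (pair2 (g (inord 1)) (g (inord 2)))
    - f (pair2 (g ord0 * g (inord 1))%g (g (inord 2)))
    + f (pair2 (g ord0) (g (inord 1) * g (inord 2))%g)
    - f (pair2 (g ord0) (g (inord 1))).
Proof.
rewrite /= !big_ord_recl big_ord0.
rewrite !(expr0, expr1, exprS, mulN1r, mul1r, addr0, opprK, mulrN1).
rewrite !addrA; congr (f _ - f _ + f _ - f _); apply/funext => -[[|[|//]] j2];
rewrite /face /pair2 /=; try congr (_ * _)%g;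
by congr g; apply/val_inj; rewrite /= ?inordK.
Qed.

Lemma cup11E (f h : cochain 1) (g : {ptws 'I_2 -> G}) :
  cup f h g = f (const1 (g ord0)) * h (const1 (g ord_max)).
Proof.
rewrite /=; congr (f _ * h _); apply/funext => j; congr g; apply/val_inj => /=;
by rewrite (ord1 j).
Qed.

Lemma cup21E (f : cochain 2) (h : cochain 1) (g : {ptws 'I_3 -> G}) :
  cup f h g = f (pair2 (g ord0) (g (inord 1))) * h (const1 (g (inord 2))).
Proof.
rewrite /=; congr (f _ * h _); apply/funext.
  by case=> -[|[|//]] j2; rewrite /pair2; congr g; apply/val_inj; rewrite /= ?inordK.
by move=> j; congr g; apply/val_inj => /=; rewrite (ord1 j) inordK.
Qed.

Lemma cup12E (f : cochain 1) (h : cochain 2) (g : {ptws 'I_3 -> G}) :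
  cup f h g = f (const1 (g ord0)) * h (pair2 (g (inord 1)) (g (inord 2))).
Proof.
rewrite /=; congr (f _ * h _); apply/funext.
  by move=> j; congr g; apply/val_inj => /=; rewrite (ord1 j).
by case=> -[|[|//]] j2; rewrite /pair2; congr g; apply/val_inj; rewrite /= ?inordK.
Qed.

Lemma differential_cup (f h : cochain 1) :
  differential (cup f h) = (cup (differential f) h : cochain 3) - cup f (differential h).
Proof.
apply: cochain_eq => g; rewrite cochainB cup21E cup12E (differential2E (cup f h)) !cup11E.
rewrite !differential1E /pair2 /=.
by ring.
Qed.

(* The value of [a] outside the index range of a defining system is irrelevant. *)
Definition defining_system n (alpha : n.-tuple (cohomology G p 1))
    (a : nat -> nat -> cochain 1) : Prop :=
  (forall i : 'I_n, represents (a i.+1 i.+2) (tnth alpha i)) /\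
  (forall i j, (1 <= i)%N -> (i.+1 < j)%N -> (j <= n.+1)%N -> (i, j) != (1, n.+1)%N ->
     differential (a i j) = \sum_(i.+1 <= l < j) (cup (a i l) (a l j) : cochain 2)).

Definition massey_cochain n (a : nat -> nat -> cochain 1) : cochain 2 :=
  \sum_(2 <= k < n.+1) cup (a 1%N k) (a k n.+1).

Definition massey_product n (alpha : n.-tuple (cohomology G p 1)) :
    set (cohomology G p 2) :=
  [set x | exists2 a, defining_system alpha a & represents (massey_cochain n a) x].

Lemma differential_represented n (f : cochain n) x :
  represents f x -> differential f = 0.
Proof. by case=> z <- _; exact/eqP/(cocycleP z). Qed.

Fact massey_cochain_cocycle n (alpha : n.-tuple (cohomology G p 1)) a :
  defining_system alpha a -> massey_cochain n a \in @cocycle_pred G p 2.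
Proof.
move=> [arep asys].
have da i j : (1 <= i)%N -> (i < j)%N -> (j <= n.+1)%N -> (i, j) != (1, n.+1)%N ->
    differential (a i j) = \sum_(i.+1 <= l < j) (cup (a i l) (a l j) : cochain 2).
  move=> i1; rewrite leq_eqVlt => /orP[/eqP<- jn _|/asys]; last exact.
  rewrite big_geq //; case: i i1 jn => // i _ jn.
  have /differential_represented := arep (Ordinal (jn : (i < n)%N)); exact.
apply/eqP; rewrite raddf_sum /=.
under eq_big_nat => k /andP[k2 kn].
  rewrite differential_cup !da ?(leq_trans _ k2) ?(ltnW kn) //; last 2 first.
  - by rewrite xpair_eqE negb_and (gtn_eqF k2).
  - by rewrite xpair_eqE negb_and orbC (ltn_eqF kn).
  over.
rewrite sumrB; apply/eqP; rewrite subr_eq0; apply/eqP.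
apply: cochain_eq => g; rewrite !cochain_sum.
under eq_bigr do rewrite cup21E cochain_sum big_distrl.
under [RHS]eq_bigr do rewrite cup12E cochain_sum big_distrr.
under eq_big_nat => k /andP[_ kn].
  rewrite (big_nat_widen _ _ n.+1 _ _ (ltnW kn)).
  over.
rewrite (exchange_big_dep_nat xpredT) //; apply: eq_big_nat => l /andP[l2 ln].
rewrite [RHS](big_nat_widenl _ 2) ?leqW //.
by apply: eq_bigr => k _; rewrite !cup11E; apply: (esym (mulrA _ _ _)).
Qed.

End Massey.

Definition global_field (K : fieldType) : Prop :=
  (exists (L : fieldExtType rat) (f : {rmorphism K -> L}), bijective f) \/
  (exists (F : finFieldType) (L : fieldExtType {fraction {poly F}})
     (f : {rmorphism K -> L}), bijective f).

Definition separable_closure (K L : fieldType) (iota : {rmorphism K -> L}) : Prop :=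
  (forall x : L, exists2 q : {poly K}, separable_poly q & root (map_poly iota q) x) /\
  (forall q : {poly L}, separable_poly q -> (1 < size q)%N -> exists x, root q x).

Section AbsoluteGaloisGroup.
Variables (K L : fieldType) (iota : {rmorphism K -> L}).

Definition automorphism_pred : {pred (L -> L)} := fun s =>
  `[< [/\ zmod_morphism s, monoid_morphism s, bijective s
        & forall x, s (iota x) = iota x] >].

Record absgal := AbsGal {
  absgal_fun :> L -> L;
  absgalP : absgal_fun \in automorphism_pred }.

HB.instance Definition _ := [isSub for absgal_fun].
HB.instance Definition _ := [Choice of absgal by <:].

Fact absgal_is_zmod_morphism (s : absgal) : zmod_morphism s.
Proof. by have /asboolP[] := absgalP s. Qed.
Fact absgal_is_monoid_morphism (s : absgal) : monoid_morphism s.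
Proof. by have /asboolP[] := absgalP s. Qed.
HB.instance Definition _ s :=
  GRing.isZmodMorphism.Build L L (absgal_fun s) (absgal_is_zmod_morphism s).
HB.instance Definition _ s :=
  GRing.isMonoidMorphism.Build L L (absgal_fun s) (absgal_is_monoid_morphism s).

Lemma absgal_bij (s : absgal) : bijective s.
Proof. by have /asboolP[] := absgalP s. Qed.
Lemma absgal_fix (s : absgal) x : s (iota x) = iota x.
Proof. by have /asboolP[] := absgalP s. Qed.

Lemma absgal_eq (s t : absgal) : (forall x, s x = t x) -> s = t.
Proof. by move=> st; apply/val_inj/funext. Qed.

Fact absgal_one_subproof : id \in automorphism_pred.
Proof. by apply/asboolP; split=> //; exists id. Qed.
Definition absgal_one := AbsGal absgal_one_subproof.

Fact absgal_mul_subproof (s t : absgal) : s \o t \in automorphism_pred.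
Proof.
apply/asboolP; split=> [x y|||x] /=; first by rewrite !raddfB.
- by split=> [|x y] /=; rewrite ?rmorph1 ?rmorphM.
- exact: bij_comp (absgal_bij s) (absgal_bij t).
- by rewrite !absgal_fix.
Qed.
Definition absgal_mul s t := AbsGal (absgal_mul_subproof s t).

Fact absgal_inv_exists (s : absgal) : exists t : absgal, cancel s t /\ cancel t s.
Proof.
have [t sK tK] := absgal_bij s.
suff tP : t \in automorphism_pred by exists (AbsGal tP).
have sI := can_inj sK; apply/asboolP; split=> [x y|||x].
- by apply: sI; rewrite absgal_is_zmod_morphism !tK.
- by split=> [|x y]; apply: sI;
  rewrite ?(absgal_is_monoid_morphism s).1 ?(absgal_is_monoid_morphism s).2 !tK.
- by exists s.
- by apply: sI; rewrite tK absgal_fix.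
Qed.
Definition absgal_inv s : absgal := projT1 (cid (absgal_inv_exists s)).

Fact absgal_mulA : associative absgal_mul. Proof. by move=> s t u; apply: absgal_eq. Qed.
Fact absgal_mul1 : left_id absgal_one absgal_mul.
Proof. by move=> s; apply: absgal_eq. Qed.
Fact absgal_mulr1 : right_id absgal_one absgal_mul.
Proof. by move=> s; apply: absgal_eq. Qed.
Lemma absgal_invK (s : absgal) : cancel s (absgal_inv s).
Proof. by rewrite /absgal_inv; case: cid => t []. Qed.
Lemma absgal_invKV (s : absgal) : cancel (absgal_inv s) s.
Proof. by rewrite /absgal_inv; case: cid => t []. Qed.
Fact absgal_mulV : left_inverse absgal_one absgal_inv absgal_mul.
Proof. by move=> s; apply: absgal_eq => x /=; rewrite absgal_invK. Qed.
Fact absgal_mulrV : right_inverse absgal_one absgal_inv absgal_mul.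
Proof. by move=> s; apply: absgal_eq => x /=; rewrite absgal_invKV. Qed.

HB.instance Definition _ :=
  isGroup.Build absgal absgal_mulA absgal_mul1 absgal_mulr1 absgal_mulV absgal_mulrV.

(* Krull topology: the automorphisms agreeing with [s] on a finite set [E] form the coset *)
(* of [s] modulo the automorphisms fixing the finitely generated extension K(E).          *)
Definition krull_open : set_system absgal :=
  [set U : set absgal | forall s : absgal, U s ->
    exists E : seq L, forall t : absgal, {in E, t =1 s} -> U t].

Fact krull_openT : krull_open setT. Proof. by move=> s _; exists [::]. Qed.
Fact krull_openI : setI_closed krull_open.
Proof.
move=> U V oU oV s [/oU[E EU] /oV[F FV]]; exists (E ++ F) => t ts.
by split; [apply: EU | apply: FV] => x xE; apply: ts; rewrite mem_cat xE ?orbT.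
Qed.
Fact krull_open_bigcup (I : Type) (f : I -> set absgal) :
  (forall i, krull_open (f i)) -> krull_open (\bigcup_i f i).
Proof.
move=> fo s [i _ /fo[E Ef]]; exists E => t /Ef; by exists i.
Qed.

HB.instance Definition _ :=
  isOpenTopological.Build absgal krull_openT krull_openI krull_open_bigcup.

Lemma krull_nbhsP (s : absgal) (U : set absgal) :
  nbhs s U <-> exists E : seq L, forall t : absgal, {in E, t =1 s} -> U t.
Proof.
split=> [|[E EU]].
  by rewrite nbhsE => -[V [oV Vs] VU]; have [E EV] := oV s Vs; exists E => t /EV/VU.
rewrite nbhsE; exists [set t : absgal | {in E, t =1 s}] => //; split=> //.
by move=> t ts; exists E => u ut x xE; rewrite ut ?ts.
Qed.

Fact absgal_mul_continuous : continuous (fun x : absgal * absgal => (x.1 * x.2)%g).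
Proof.
move=> [s t] U /krull_nbhsP[E EU].
exists ([set s' : absgal | {in map t E, s' =1 s}], [set t' : absgal | {in E, t' =1 t}]).
  split; apply/krull_nbhsP; [by exists (map t E) | by exists E].
move=> [s' t'] /= [ss tt]; apply: EU => x xE /=.
by rewrite tt // ss ?map_f.
Qed.

Fact absgal_inv_continuous : continuous (fun x : absgal => x^-1%g).
Proof.
move=> s U /krull_nbhsP[E EU]; apply/krull_nbhsP.
exists (map (absgal_inv s) E) => t ts; apply: EU => x xE.
apply: (can_inj (absgal_invK t)); rewrite [LHS]absgal_invKV ts ?map_f //.
by rewrite [RHS]absgal_invKV.
Qed.

HB.instance Definition _ :=
  isTopologicalGroup.Build absgal absgal_mul_continuous absgal_inv_continuous.

End AbsoluteGaloisGroup.

Section KummerCharacter.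
Variables (p : nat) (K L : fieldType) (iota : {rmorphism K -> L}) (zeta : K).
Local Notation G := (absgal iota).

Definition kummer_cocycle (a : K) : set (cocycle G p 1) :=
  [set z : cocycle G p 1 | forall (s : G) (x : L), x ^+ p = iota a ->
             s x = iota zeta ^+ (z (const1 s)) * x].

(* The default value [0] of [xget] is never used when the hypotheses of *)
(* [kummer_cocycle_xget] hold.                                           *)
Definition kummer_char (a : K) : cohomology G p 1 :=
  cohomology_class (xget 0 (kummer_cocycle a)).

Hypotheses (p_pr : prime p) (sepL : separable_closure iota).
Hypothesis (zeta_prim : p.-primitive_root zeta).

Let z_prim : p.-primitive_root (iota zeta).
Proof. by rewrite fmorph_primitive_root. Qed.

Lemma kummer_root_exists (a : K) : a != 0 -> exists x : L, x ^+ p = iota a.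
Proof.
move=> a0; have p0 := prime_gt0 p_pr; have szq := size_XnsubC (iota a) p0.
have [||x] := sepL.2 ('X^p - (iota a)%:P).
- rewrite unlock derivB derivC subr0 derivXn -scaler_nat coprimepZr.
    rewrite coprimep_expr // coprimepX.
    by rewrite /root !hornerE expr0n gtn_eqF //= sub0r oppr_eq0 fmorph_eq0.
  exact: prim_root_natf_neq0 z_prim.
- by rewrite szq ltnS.
- by rewrite /root !hornerE subr_eq0 => /eqP; exists x.
Qed.

Lemma Fp_val_lt (k : 'F_p) : (k < p)%N.
Proof. by rewrite -[X in (_ < X)%N](Fp_cast p_pr). Qed.

Lemma zeta_Fp_inj (k l : 'F_p) : iota zeta ^+ k = iota zeta ^+ l -> k = l.
Proof.
move/eqP; rewrite (eq_prim_root_expr z_prim) !modn_small ?Fp_val_lt // => /eqP.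
exact: val_inj.
Qed.

Lemma zeta_FpD (k l : 'F_p) : iota zeta ^+ (k + l)%R = iota zeta ^+ k * iota zeta ^+ l.
Proof. by rewrite -exprD /= [X in (_ %% X)%N](Fp_cast p_pr) (prim_expr_mod z_prim). Qed.

Lemma kummer_cocycle_exists (a : K) : a != 0 -> kummer_cocycle a !=set0.
Proof.
move=> a0; have [r rE] := kummer_root_exists a0; have p0 := prime_gt0 p_pr.
have r0 : r != 0.
  apply: contra_neq a0 => r0; apply: (fmorph_inj iota).
  by rewrite -rE r0 expr0n gtn_eqF ?rmorph0.
have rootE x : x ^+ p = iota a -> exists k : 'F_p, x = iota zeta ^+ k * r.
  move=> xE; have : (x / r) ^+ p = 1 by rewrite expr_div_n xE rE divff // fmorph_eq0.
  move/(prim_rootP z_prim) => [i iE]; exists i%:R.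
  by rewrite val_Fp_nat // (prim_expr_mod z_prim) -iE divfK.
have sE (s : G) : (s r) ^+ p = iota a by rewrite -rmorphXn rE /= absgal_fix.
have [k kE] := choice (fun s : G => rootE _ (sE s)).
have kI (s : G) (l : 'F_p) : s r = iota zeta ^+ l * r -> l = k s.
  by rewrite kE => /(mulIf r0)/zeta_Fp_inj.
have fc : (fun g : {ptws 'I_1 -> G} => k (g ord0)) \in @cochain_pred G p 1.
  apply/cochain_predP => g.
  have near_r : nbhs (g ord0) [set s : G | s r = g ord0 r].
    by apply/krull_nbhsP; exists [:: r] => t; apply; rewrite inE.
  have gc := @proj_continuous 'I_1 (fun=> G) ord0 g _ near_r.
  apply: (@filterS _ (nbhs (g : {ptws _ -> _})) _ _ _ _ gc) => h hr.
  by apply/esym/kI/(etrans (hr : h ord0 r = g ord0 r)); exact: kE.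
have fz : Cochain fc \in @cocycle_pred G p 1.
  apply/eqP/cochain_eq => g; rewrite differential1E /= /const1.
  rewrite -[k (_ * _)%g](kI _ (k (g ord0) + k (g ord_max))) ?opprD ?addrA.
    by rewrite [X in X + _]addrAC subrr sub0r addNr.
  rewrite /= kE rmorphM rmorphXn /= absgal_fix kE zeta_FpD mulrA; congr (_ * _).
  exact: mulrC.
exists (Cocycle fz) => s x /rootE[l ->] /=.
by rewrite rmorphM rmorphXn /= absgal_fix kE /const1 mulrCA.
Qed.

Lemma kummer_cocycle_xget (a : K) :
  a != 0 -> kummer_cocycle a (xget 0 (kummer_cocycle a)).
Proof. by move/kummer_cocycle_exists/(xgetPex 0). Qed.

Lemma kummer_cocycle_uniq (a : K) (y z : cocycle G p 1) :
  a != 0 -> kummer_cocycle a y -> kummer_cocycle a z -> y = z.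
Proof.
move=> a0 ya za; have [r rE] := kummer_root_exists a0.
have r0 : r != 0.
  apply: contra_neq a0 => r0; apply: (fmorph_inj iota).
  by rewrite -rE r0 expr0n gtn_eqF ?prime_gt0 ?rmorph0.
apply/val_inj/cochain_eq => g.
have -> : g = const1 (g ord0) by apply/funext => i; rewrite (ord1 i).
by apply: zeta_Fp_inj; apply: (mulIf r0); rewrite -ya // -za.
Qed.

End KummerCharacter.

(* Main.v *)
From HB Require Import structures.
Require Import Defs.
From mathcomp Require Import all_boot all_order all_algebra all_field.
From mathcomp Require Import ring boolp classical_sets functions cardinality topology.

(** Write [V] for the multiplicative group of the separable closure, additively, and [G] for the
    Galois group. The defining system provides characters [chi1], [chi2], [chi3] and the
    vanishing of the cup products of neighbours. The task is to find a homomorphism from [G] to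
    unipotent 4 x 4 matrices over ['F_p] with [chi1], [chi2], [chi3] above the diagonal. The
    arithmetic inputs are Kummer theory and Hilbert 90.

    Let [b] in [V] be a p-th root of an element whose Kummer character is [chi2]. As the cup
    products vanish, [p b] is the norm of some [alpha] from the cyclic extension cut out by
    [chi1] and of some [gamma] from the one cut out by [chi3] ([norm_element]). In the
    compositum, [alpha - gamma] has norm zero for the diagonal of the bicyclic Galois group,
    so it is a difference along the diagonal ([diagonal_primitive]). This makes a system of two
    difference equations, one in each direction, closed; its solution [T] ([theta_exists]) is a
    p-th root of an element of the compositum. The Kummer cocycle of [T] takes values in
    functions affine in each direction, and its coefficients are the matrix entries
    ([unipotent_lift]).

    Instead of field extensions, which may be trivial or coincide, the
    proof uses functions on the cycle ['F_p] and on the torus ['F_p * 'F_p], with [G] acting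
    on ['F_p] by translation through the characters: equivariant functions are the
    elements of the corresponding etale algebras. All cases of dependence between the characters
    are thus treated at once. Hilbert 90 in this form ([hilbert90_absgal]) follows from Poincare
    series and independence of characters. *)

Set Implicit Arguments.
Unset Strict Implicit.
Unset Printing Implicit Defensive.

Import GRing.Theory.
Local Open Scope classical_set_scope.
Local Open Scope ring_scope.

(** * Identities in abelian groups *)

Lemma addr_cancel (V : zmodType) (s q r t : V) :
  s = q - t -> q = r + t -> r = 0 -> s = 0.
Proof. by move=> -> -> ->; rewrite addrK. Qed.

(** Moves to the end of a left-nested sum the term that the right-hand side has there. *)
Ltac bring_last :=
  first [ reflexivity
        | refine (etrans (congr1 (fun z => z + _) _) (addrAC _ _ _)); bring_last
        | exact: (esym (add0r _)) ].

(** Decides identities that hold in every abelian group: the difference of the two sides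
    is flattened to a left-nested sum, from which opposite terms are removed in pairs. *)
Ltac abelian_group :=
  apply/eqP; rewrite -subr_eq0; apply/eqP; rewrite ?(opprD, opprK, oppr0, addr0, add0r, addrA);
  repeat match goal with |- ?s = 0 =>
    match s with context [- ?t] =>
      refine (@addr_cancel _ s _ _ t _ _ _); [bring_last | bring_last |]
    end end; exact: erefl.

(** * Difference equations on the cycle and on the torus *)

Section FiniteDifferences.
Variables (p : nat) (V : zmodType).
Hypothesis p_pr : prime p.

Lemma Fp_ind (P : 'F_p -> Prop) : P 0 -> (forall i, P i -> P (i + 1)) -> forall i, P i.
Proof.
move=> P0 PS i; rewrite -(natr_Zp i); elim: (nat_of_ord i) => [//|k].
by rewrite -natr1 => /PS.
Qed.

Lemma Fp_funext (u v : 'F_p -> V) :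
  u 0 = v 0 -> (forall i, u (i + 1) - u i = v (i + 1) - v i) -> u =1 v.
Proof.
move=> uv0 uvS; apply: Fp_ind => [//|i uv].
by rewrite -[LHS](subrK (u i)) uvS uv subrK.
Qed.

Lemma Fp_constant (u : 'F_p -> V) : (forall i, u (i + 1) = u i) -> forall i, u i = u 0.
Proof. by move=> uS; apply: Fp_ind => // i; rewrite uS. Qed.

Lemma sumr_translate (u : 'F_p -> V) j : \sum_i u (i + j) = \sum_i u i.
Proof. by rewrite [RHS](reindex_inj (addIr j)). Qed.

Lemma sumr_Fp_const (v : V) : \sum_(i : 'F_p) v = v *+ p.
Proof. by rewrite sumr_const card_Fp. Qed.

(** A function on a cycle is a difference as soon as its sum around the cycle vanishes; this
    stands in for Hilbert 90 wherever no Galois action has to be respected. *)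
Lemma Fp_primitive (u : 'F_p -> V) : \sum_i u i = 0 ->
  exists2 U : 'F_p -> V, U 0 = 0 & forall i, U (i + 1) - U i = u i.
Proof.
move=> u0; pose U n := \sum_(0 <= k < n) u k%:R.
have Up : U p = 0.
  rewrite -u0 -(eq_bigr _ (fun i _ => congr1 u (natr_Zp i))).
  by rewrite -(big_mkord xpredT (fun k => u k%:R)) (Fp_cast p_pr).
exists (fun i => U i); first by rewrite /U big_geq.
move=> i; have iE : i = (i : nat)%:R by rewrite natr_Zp.
(* The wrap-around from p - 1 to 0 is where the vanishing of the sum is used. *)
have -> : U (i + 1)%R = U (i : nat).+1.
  rewrite [in LHS]iE natr1 val_Fp_nat //.
  have := Fp_val_lt p_pr i; rewrite leq_eqVlt => /predU1P[->|/modn_small->//].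
  by rewrite modnn Up /U big_geq.
by rewrite /U big_nat_recr //= addrAC subrr add0r natr_Zp.
Qed.

(** A closed discrete 1-form on the torus is exact when its periods vanish. By closedness all
    the horizontal periods agree, so that the one at height [0] suffices. *)
Lemma torus_primitive (X Y : 'F_p -> 'F_p -> V) :
    (forall i j, X (i + 1) j - X i j = Y i (j + 1) - Y i j) ->
    (forall i, \sum_j X i j = 0) -> \sum_i Y i 0 = 0 ->
  exists2 T : 'F_p -> 'F_p -> V,
    forall i j, T (i + 1) j - T i j = Y i j & forall i j, T i (j + 1) - T i j = X i j.
Proof.
move=> XY X0 Y0; have [U _ US] := Fp_primitive Y0.
have [W W0 WS] : exists2 W : 'F_p -> 'F_p -> V, forall i, W i 0 = 0
    & forall i j, W i (j + 1) - W i j = X i j.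
  have /choice[W WP] : forall i, exists Wi : 'F_p -> V,
      Wi 0 = 0 /\ forall j, Wi (j + 1) - Wi j = X i j.
    by move=> i; have [Wi] := Fp_primitive (X0 i); exists Wi.
  by exists W => i; have [] := WP i.
exists (fun i j => U i + W i j) => [i|i j]; last first.
  by rewrite opprD addrACA subrr add0r WS.
apply: Fp_funext => [|j]; first by rewrite !W0 !addr0 US.
have -> : Y i (j + 1) = Y i j + (X (i + 1) j - X i j) by rewrite XY; abelian_group.
by rewrite -!WS; abelian_group.
Qed.

End FiniteDifferences.

Lemma Fp_affine p (u : 'F_p -> 'F_p) d :
  (forall i, u (i + 1) - u i = d) -> forall i, u i = u 0 + i * d.
Proof.
by move=> uS; apply: Fp_funext => [|i]; rewrite ?uS; ring.
Qed.

(** * Cochains of degree one and two *)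

Section LowDegreeCochains.
Variables (G : topologicalGroupType) (p : nat).

Definition locconst (f : G -> 'F_p) := forall g, \forall t \near g, f t = f g.

Lemma morph1 (f : G -> 'F_p) : {morph f : g h / (g * h)%g >-> g + h} -> f 1%g = 0.
Proof. by move=> fM; apply: (addrI (f 1%g)); rewrite -fM mulg1 addr0. Qed.

Lemma morph_near0 (f : G -> 'F_p) : {morph f : g h / (g * h)%g >-> g + h} ->
  locconst f -> \forall t \near (1%g : G), f t = 0.
Proof. by move=> fM fc; rewrite -(morph1 fM); exact: fc. Qed.

Lemma cochain1_locconst (F : cochain G p 1) : locconst (fun g => F (const1 g)).
Proof. by move=> g; apply: (cochain_comp_near (h := @const1 G)) => i x; exact: cvg_id. Qed.

Lemma cochain1_exists (u : G -> 'F_p) : locconst u ->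
  exists F : cochain G p 1, forall g, F (const1 g) = u g.
Proof.
move=> uc; have Fc : (fun g : {ptws 'I_1 -> G} => u (g ord0)) \in @cochain_pred G p 1.
  apply/cochain_predP => g.
  exact: (@proj_continuous 'I_1 (fun=> G) ord0 g _ (uc (g ord0))).
by exists (Cochain Fc).
Qed.

Lemma differential1_const1 (F : cochain G p 1) x y :
  differential F (pair2 x y) = F (const1 y) - F (const1 (x * y)%g) + F (const1 x).
Proof. by rewrite differential1E. Qed.

Lemma cocycle1_morph (F : cochain G p 1) : differential F = 0 ->
  {morph (fun g => F (const1 g)) : g h / (g * h)%g >-> g + h}.
Proof.
move=> F0 g h; apply/esym/subr0_eq; transitivity (differential F (pair2 g h)).
  by rewrite differential1_const1; ring.
by rewrite F0.
Qed.

Lemma cochain2_eq (F H : cochain G p 2) :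
  (forall x y, F (pair2 x y) = H (pair2 x y)) -> F = H.
Proof.
move=> FH; apply: cochain_eq => g.
have -> : g = pair2 (g ord0) (g ord_max); last exact: FH.
by apply/funext => -[[|[|//]] j2]; rewrite /pair2; congr g; exact/val_inj.
Qed.

(** A 1-cochain with prescribed differential is a function that fails to be additive by a
    prescribed amount; defining systems are handled in this form only. *)
Lemma differential1P (F : cochain G p 1) (M : cochain G p 2) : differential F = M <->
  forall g h, F (const1 (g * h)%g) = F (const1 g) + F (const1 h) - M (pair2 g h).
Proof.
split=> [<- g h|FM]; first by rewrite differential1_const1; ring.
by apply: cochain2_eq => g h; rewrite differential1_const1 FM; ring.
Qed.

End LowDegreeCochains.

(** * Massey products over a group with a Hilbert 90 module

    [V] is a discrete [G]-module in the role of the multiplicative group of a separable closure,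
    with [mu] in the role of the p-th roots of unity. For an additive [chi : G -> 'F_p],
    the maps ['F_p -> V] form a [G]-module in which [g] carries [phi] to the map whose value at
    [i + chi g] is [act g (phi i)]. In [hilbert90], [c g i] is the value at [i + chi g] of the
    cocycle attached to [g], which keeps all signs out of the cocycle identity. Since
    the module is a sum of copies of [V] or is coinduced from the kernel of [chi], its first
    cohomology vanishes by Hilbert 90 and Shapiro's lemma. *)

Section KummerModule.
Variables (G : topologicalGroupType) (p : nat) (V : zmodType).
Variables (act : G -> {additive V -> V}) (mu : {additive 'F_p -> V}).
Hypothesis p_pr : prime p.
Hypothesis act1 : forall v, act 1%g v = v.
Hypothesis actM : forall g h v, act (g * h)%g v = act g (act h v).
Hypothesis act_near : forall g v, \forall t \near g, act t v = act g v.
Hypothesis act_mu : forall g k, act g (mu k) = mu k.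
Hypothesis mu_inj : injective mu.
Hypothesis mu_torsion : forall v : V, v *+ p = 0 -> exists k, v = mu k.
Hypothesis divisible : forall v : V, exists w : V, w *+ p = v.
Hypothesis hilbert90 : forall (chi : G -> 'F_p) (c : G -> 'F_p -> V),
  {morph chi : g h / (g * h)%g >-> g + h} ->
  (forall g h i, c (g * h)%g i = act g (c h i) + c g (i + chi h)) ->
  (\forall t \near (1%g : G), chi t = 0 /\ forall i, c t i = 0) ->
  exists phi, forall g i, c g i = act g (phi i) - phi (i + chi g).

Lemma act_near1 v : \forall t \near (1%g : G), act t v = v.
Proof. by have := act_near 1%g v; rewrite act1. Qed.

(** A cochain [e] that bounds, up to sign, the cup product of [psi] and [chi] gives a cocycle
    whose values are affine functions of [i]; Hilbert 90 then turns it into a function [A] with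
    values in [V]. In multiplicative terms [A] collects p-th roots of partial norms. *)
Lemma hilbert90_mu (chi psi e : G -> 'F_p) :
  {morph chi : g h / (g * h)%g >-> g + h} ->
  {morph psi : g h / (g * h)%g >-> g + h} ->
  (forall g h, e (g * h)%g = e g + e h + psi g * chi h) ->
  locconst chi -> locconst psi -> locconst e ->
  exists A, forall g i, act g (A i) - A (i + chi g) = mu (e g + i * psi g).
Proof.
move=> chiM psiM eM chi_near psi_near e_near.
have [g h i||A AP] := @hilbert90 chi (fun g i => mu (e g + i * psi g)) chiM.
- by rewrite act_mu -raddfD eM psiM; congr (mu _); ring.
- near=> t.
  have -> : chi t = 0 by near: t; exact: morph_near0.
  have -> : psi t = 0 by near: t; exact: morph_near0.
  have -> : e t = 0.
    have := eM 1%g 1%g; rewrite mulg1 (morph1 chiM) mulr0 addr0 => /esym/eqP.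
    rewrite -subr_eq0 addrK => /eqP e1.
    by rewrite -e1; near: t; exact: e_near.
  by split=> // i; rewrite mulr0 addr0 raddf0.
- by exists A => g i; rewrite AP.
Unshelve. all: by end_near. Qed.

(** If [b] is a p-th root of an element of the base, that element is a norm from the
    cyclic extension cut out by [chi]: the element with this norm is [b] minus the difference
    of [A], and the difference telescopes in the sum. *)
Lemma norm_element (chi psi e : G -> 'F_p) (b : V) (A : 'F_p -> V) :
    (forall g, act g b - b = mu (psi g)) ->
    (forall g i, act g (A i) - A (i + chi g) = mu (e g + i * psi g)) ->
  exists alpha : 'F_p -> V, [/\ forall i, A (i + 1) - A i = b - alpha i,
    forall g i, act g (alpha i) = alpha (i + chi g) & \sum_i alpha i = b *+ p].
Proof.
move=> bP AP; exists (fun i => b - (A (i + 1) - A i)); split=> [i|g i|].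
- abelian_group.
- rewrite !raddfB /=.
  have -> : act g b = mu (psi g) + b by rewrite -bP subrK.
  have AE j : act g (A j) = mu (e g + j * psi g) + A (j + chi g) by rewrite -AP subrK.
  rewrite !AE (_ : e g + (i + 1) * psi g = e g + i * psi g + psi g); last by ring.
  rewrite [mu (_ + psi g)]raddfD [i + chi g + 1]addrAC.
  abelian_group.
- by rewrite sumrB sumr_Fp_const // sumrB (sumr_translate (A : 'F_p -> V)) subrr subr0.
Qed.

(** A p-th root of the differences of [D] becomes one of [D] after a change of the
    constant of summation. *)
Lemma divide_primitive (A D : 'F_p -> V) :
    (forall i, (A (i + 1) - A i) *+ p = D (i + 1) - D i) ->
  exists k, forall i, (A i + k) *+ p = D i.
Proof.
move=> AD; have [k kE] := divisible (D 0 - A 0 *+ p).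
exists k; apply: Fp_funext => [|i]; first by rewrite mulrnDl kE addrC subrK.
by rewrite -AD mulrnBl !mulrnDl; abelian_group.
Qed.

(** ** Lifting to unipotent 4 x 4 matrices *)

Section Lift.
Variables (chi1 chi2 chi3 : G -> 'F_p).
Hypothesis chi1M : {morph chi1 : g h / (g * h)%g >-> g + h}.
Hypothesis chi2M : {morph chi2 : g h / (g * h)%g >-> g + h}.
Hypothesis chi3M : {morph chi3 : g h / (g * h)%g >-> g + h}.
Hypotheses (chi1_near : locconst chi1) (chi2_near : locconst chi2) (chi3_near : locconst chi3).

(** Hilbert 90 for the diagonal translation of the torus: [alpha] and [gamma] have equal norms,
    hence their quotient, which has norm one along the diagonals, is a difference along them.
    A non-equivariant solution comes from summation along each diagonal; its defect of
    equivariance is constant on diagonals, which [G] permutes through [chi3 - chi1]. *)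
Lemma diagonal_primitive (alpha gamma : 'F_p -> V) :
    (forall g i, act g (alpha i) = alpha (i + chi1 g)) ->
    (forall g i, act g (gamma i) = gamma (i + chi3 g)) ->
    \sum_i alpha i = \sum_i gamma i ->
  exists2 d : 'F_p -> 'F_p -> V,
    forall g i j, act g (d i j) = d (i + chi1 g) (j + chi3 g) &
    forall i j, d (i + 1) (j + 1) - d i j = alpha i - gamma j.
Proof.
move=> alphaE gammaE ag.
have /choice[U UP] : forall m : 'F_p, exists Um : 'F_p -> V,
    forall k, Um (k + 1) - Um k = alpha k - gamma (k + m).
  move=> m.
  have [|Um _ UmP] := @Fp_primitive _ _ p_pr (fun k : 'F_p => alpha k - gamma (k + m)).
    by rewrite sumrB (sumr_translate gamma) ag subrr.
  by exists Um.
(* The diagonals are indexed by m = j - i. *)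
pose d (i j : 'F_p) := U (j - i) i.
have dP i j : d (i + 1) (j + 1) - d i j = alpha i - gamma j.
  by rewrite /d (_ : j + 1 - (i + 1) = j - i); [rewrite UP [i + _]addrC subrK|ring].
pose c g (i j : 'F_p) := act g (d i j) - d (i + chi1 g) (j + chi3 g).
have cS g i j : c g (i + 1) (j + 1) = c g i j.
  have dE k l : d (k + 1) (l + 1) = d k l + (alpha k - gamma l).
    by rewrite -dP; abelian_group.
  rewrite /c dE ![_ + 1 + _]addrAC dE !raddfD /= !raddfN /= alphaE gammaE.
  abelian_group.
have cE g i j : c g i j = c g 0 (j - i).
  have := @Fp_constant _ _ (fun k : 'F_p => c g k (k + (j - i))) _ i.
  rewrite /= add0r [i + _]addrC subrK; apply=> k.
  by rewrite -[RHS]cS addrAC.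
have [|g h m||w wP] := @hilbert90 (fun g => chi3 g - chi1 g) (fun g m => c g 0 m).
- by move=> g h; rewrite chi1M chi3M; ring.
- transitivity (act g (c h 0 m) + c g (chi1 h) (m + chi3 h)).
    rewrite /c actM chi1M chi3M raddfB /= !add0r [chi1 g + _]addrC.
    rewrite (_ : m + (chi3 g + chi3 h) = m + chi3 h + chi3 g); last by ring.
    abelian_group.
  by rewrite [c g (chi1 h) _]cE; congr (_ + c g 0 _); rewrite addrA.
- near=> t.
  have chi1t : chi1 t = 0 by near: t; exact: morph_near0.
  have chi3t : chi3 t = 0 by near: t; exact: morph_near0.
  rewrite chi1t chi3t subr0; split=> // i.
  rewrite /c chi1t chi3t !addr0 (_ : act t (d 0 i) = d 0 i) ?subrr //.
  move: i; near: t; apply: filter_forall => i; exact: act_near1.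
exists (fun i j => d i j - w (j - i)) => [g i j|i j].
  have : c g i j = act g (w (j - i)) - w (j - i + (chi3 g - chi1 g)) by rewrite cE wP.
  rewrite /c (_ : j + chi3 g - (i + chi1 g) = j - i + (chi3 g - chi1 g)); last by ring.
  move=> cw; rewrite raddfB /= (_ : act g (d i j) = d (i + chi1 g) (j + chi3 g)
    + (act g (w (j - i)) - w (j - i + (chi3 g - chi1 g)))); last by rewrite -cw; abelian_group.
  abelian_group.
rewrite (_ : j + 1 - (i + 1) = j - i); last by ring.
rewrite -dP; abelian_group.
Unshelve. all: by end_near. Qed.

Variables (e1 e3 : G -> 'F_p).
Hypothesis e1M : forall g h, e1 (g * h)%g = e1 g + e1 h + chi2 g * chi1 h.
Hypothesis e3M : forall g h, e3 (g * h)%g = e3 g + e3 h + chi2 g * chi3 h.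
Hypotheses (e1_near : locconst e1) (e3_near : locconst e3).

(** The function [T] is a p-th root of an element of the compositum of the two cyclic
    extensions cut out by [chi1] and [chi3]. Up to constants, the differences of [T] in the two
    directions are [A i] plus an equivariant function and [C j] plus another one; their closedness
    on the torus is the equation solved by [diagonal_primitive]. Hence the defect of
    equivariance of [T] has differences that are affine with slope [chi2]. *)
Lemma theta_exists : exists (T : 'F_p -> 'F_p -> V) (ka kc : G -> V),
  let c g i j := act g (T i j) - T (i + chi1 g) (j + chi3 g) in
  [/\ forall g i j, c g i j *+ p = 0,
      forall g i j, c g i (j + 1) - c g i j = mu (i * chi2 g) + ka g &
      forall g i j, c g (i + 1) j - c g i j = mu (j * chi2 g) + kc g].
Proof.
have [A AP] := hilbert90_mu chi1M chi2M e1M chi1_near chi2_near e1_near.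
have [C CP] := hilbert90_mu chi3M chi2M e3M chi3_near chi2_near e3_near.
(* Hilbert 90 for V itself is the case of the trivial translation. *)
have [b bP] : exists b, forall g, act g b - b = mu (chi2 g).
  have [||||||B BP] := @hilbert90_mu (fun=> 0) (fun=> 0) chi2; rewrite //.
  - by move=> *; rewrite addr0.
  - by move=> *; rewrite addr0.
  - by move=> *; rewrite mul0r addr0 chi2M.
  - by move=> g; near=> t.
  - by move=> g; near=> t.
  by exists (B 0) => g; have := BP g 0; rewrite mulr0 !addr0.
have [alpha [Aalpha alphaE alphaN]] := norm_element bP AP.
have [gamma [Cgamma gammaE gammaN]] := norm_element bP CP.
have [|d dE dP] := diagonal_primitive alphaE gammaE; first by rewrite alphaN.
have dS i j : d (i + 1) (j + 1) = d i j + (alpha i - gamma j).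
  by rewrite -dP; abelian_group.
have [i|ka kaP] := @divide_primitive A (fun i => - \sum_j d i j).
  rewrite Aalpha -(sumr_translate (fun j => d (i + 1) j) 1) (eq_bigr _ (fun j _ => dS i j)).
  rewrite big_split /= sumrB sumr_Fp_const // gammaN mulrnBl; abelian_group.
have [j|kc kcP] := @divide_primitive C (fun j => \sum_i d i j).
  rewrite Cgamma -(sumr_translate (fun i => d i (j + 1)) 1) (eq_bigr _ (fun i _ => dS i j)).
  rewrite big_split /= sumrB sumr_Fp_const // alphaN mulrnBl; abelian_group.
(* The constants ka and kc make the periods of X and Y vanish: the sum of X over j is
   p (A i + ka) plus the sum of d i over j, and similarly for Y. *)
pose X i j := A i + ka + d i (j + 1).
pose Y i j := C j + kc - d i j.
have [i j|i||T TY TX] := @torus_primitive _ _ p_pr X Y.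
- have AE : A (i + 1) = A i + (b - alpha i) by rewrite -Aalpha; abelian_group.
  have CE : C (j + 1) = C j + (b - gamma j) by rewrite -Cgamma; abelian_group.
  rewrite /X /Y dS AE CE; abelian_group.
- rewrite big_split /= sumr_Fp_const // kaP (sumr_translate (fun j => d i j)); abelian_group.
- by rewrite sumrB sumr_Fp_const // kcP subrr.
pose c (U : 'F_p -> 'F_p -> V) g i j := act g (U i j) - U (i + chi1 g) (j + chi3 g).
have cX g i j : c T g i (j + 1) - c T g i j = c X g i j.
  rewrite /c -!TX [act g (_ - _)]raddfB /= [j + 1 + _]addrAC; abelian_group.
have cY g i j : c T g (i + 1) j - c T g i j = c Y g i j.
  rewrite /c -!TY [act g (_ - _)]raddfB /= [i + 1 + _]addrAC; abelian_group.
have cXE g i j : c X g i j = mu (e1 g + i * chi2 g) + (act g ka - ka).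
  rewrite -AP /c /X !raddfD /= dE [j + 1 + _]addrAC; abelian_group.
have cYE g i j : c Y g i j = mu (e3 g + j * chi2 g) + (act g kc - kc).
  rewrite -CP /c /Y !raddfD /= !raddfN /= dE; abelian_group.
have equiv_p (W : 'F_p -> 'F_p -> V) (D : 'F_p -> 'F_p -> V) :
    (forall g i j, act g (D i j) = D (i + chi1 g) (j + chi3 g)) ->
    (forall i j, W i j *+ p = D i j) -> forall g i j, c W g i j *+ p = 0.
  by move=> DE WD g i j; rewrite /c mulrnBl -raddfMn !WD DE subrr.
have cXp : forall g i j, c X g i j *+ p = 0.
  apply: (equiv_p _ (fun i j => - \sum_k d i k + d i (j + 1) *+ p)) => [g i j|i j].
    rewrite raddfD raddfN raddfMn raddf_sum /= dE [j + 1 + _]addrAC; congr (- _ + _).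
    by rewrite -[RHS](sumr_translate _ (chi3 g)); apply: eq_bigr => k _; rewrite dE.
  by rewrite mulrnDl kaP.
have cYp : forall g i j, c Y g i j *+ p = 0.
  apply: (equiv_p _ (fun i j => \sum_k d k j - d i j *+ p)) => [g i j|i j].
    rewrite raddfB raddfMn raddf_sum /= dE; congr (_ - _).
    by rewrite -[RHS](sumr_translate (d^~ _) (chi1 g)); apply: eq_bigr => k _; rewrite dE.
  by rewrite mulrnBl kcP.
(* T *+ p is equivariant up to a cocycle independent of (i, j), removed below by Hilbert 90. *)
have cTp g i j : c T g i j *+ p = c T g 0 0 *+ p.
  transitivity (c T g i 0 *+ p).
    by apply: (@Fp_constant _ _ (fun j => c T g i j *+ p)) => {}j;
      apply/eqP; rewrite -subr_eq0 -mulrnBl cX cXp.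
  by apply: (@Fp_constant _ _ (fun i => c T g i 0 *+ p)) => {}i;
    apply/eqP; rewrite -subr_eq0 -mulrnBl cY cYp.
have [w wP] : exists w, forall g, c T g 0 0 *+ p = act g w - w.
  have [|g h _||w wP] := @hilbert90 (fun=> 0) (fun g _ => c T g 0 0 *+ p).
  - by move=> g h; rewrite addr0.
  - rewrite -[X in _ = _ + X](cTp g (chi1 h) (chi3 h)) raddfMn -mulrnDl /=; congr (_ *+ _).
    rewrite /c actM chi1M chi3M raddfB /= !add0r [chi1 g + _]addrC [chi3 g + _]addrC; abelian_group.
  - near=> t; split=> // _.
    have chi1t : chi1 t = 0 by near: t; exact: morph_near0.
    have chi3t : chi3 t = 0 by near: t; exact: morph_near0.
    rewrite /c chi1t chi3t !addr0 (_ : act t (T 0 0) = T 0 0) ?subrr ?mul0rn //.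
    near: t; exact: act_near1.
  - by exists (w 0) => g; rewrite (wP g 0) addr0.
(* Subtracting a constant from T leaves its differences unchanged. *)
have [v vP] := divisible w.
exists (fun i j => T i j - v), (fun g => mu (e1 g) + (act g ka - ka)),
  (fun g => mu (e3 g) + (act g kc - kc)) => c'.
have cE g i j : c' g i j = c T g i j - (act g v - v).
  rewrite /c' /c raddfB /=; abelian_group.
split=> g i j.
- by rewrite cE mulrnBl cTp wP -vP raddfMn mulrnBl subrr.
- transitivity (c X g i j); first by rewrite -cX !cE; abelian_group.
  rewrite cXE raddfD; abelian_group.
- transitivity (c Y g i j); first by rewrite -cY !cE; abelian_group.
  rewrite cYE raddfD; abelian_group.
Unshelve. all: by end_near. Qed.

(** The defect of equivariance of [T] is p-torsion, so it is [mu] of a function to ['F_p];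
    this function is affine in each of [i] and [j], and its coefficients are the entries of
    the sought representation. The identities are those of a cocycle with values in the
    functions [f14 + i f24 + j f13 + i j chi2] on the torus. *)
Lemma unipotent_lift : exists f14 f24 f13 : G -> 'F_p,
  [/\ locconst f14, locconst f24 & locconst f13] /\
  [/\ forall g h, f24 (g * h)%g = f24 g + f24 h + chi2 g * chi3 h,
      forall g h, f13 (g * h)%g = f13 g + f13 h + chi2 g * chi1 h &
      forall g h, f14 (g * h)%g =
        f14 g + f14 h + (chi1 h * f24 g + chi3 h * f13 g + chi1 h * chi3 h * chi2 g)].
Proof.
have [T [ka [kc]]] := theta_exists; set c := fun g i j => _ => -[/= cp ca cc].
have zp k : mu k *+ p = 0 by rewrite -raddfMn /= -mulr_natr pchar_Fp_0 // mulr0 raddf0.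
have /choice[F FP] : forall x : G * ('F_p * 'F_p), exists k, c x.1 x.2.1 x.2.2 = mu k.
  by move=> x; exact/mu_torsion/cp.
have {FP} [f fP] : exists f : G -> 'F_p -> 'F_p -> 'F_p, forall g i j, c g i j = mu (f g i j).
  by exists (fun g i j => F (g, (i, j))) => g i j; exact: (FP (g, (i, j))).
have fS1 g i j : f g (i + 1) j - f g i j - j * chi2 g = f g 1 0 - f g 0 0.
  apply: mu_inj; rewrite !raddfB /= -!fP cc.
  have := cc g 0 0; rewrite add0r mul0r raddf0 => ->; abelian_group.
have fS2 g i j : f g i (j + 1) - f g i j - i * chi2 g = f g 0 1 - f g 0 0.
  apply: mu_inj; rewrite !raddfB /= -!fP ca.
  have := ca g 0 0; rewrite add0r mul0r raddf0 => ->; abelian_group.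
pose f24 g := f g 1 0 - f g 0 0; pose f13 g := f g 0 1 - f g 0 0.
have fE g i j : f g i j = f g 0 0 + i * f24 g + j * f13 g + i * j * chi2 g.
  rewrite (@Fp_affine _ (f g i) (f13 g + i * chi2 g)); last first.
    by move=> {}j; rewrite /f13 -(fS2 g i j); ring.
  rewrite (@Fp_affine _ (fun i => f g i 0) (f24 g)); first by ring.
  by move=> {}i; rewrite /f24 -(fS1 g i 0) mul0r subr0.
have fM g h i j : f (g * h)%g i j = f h i j + f g (i + chi1 h) (j + chi3 h).
  apply: mu_inj; rewrite raddfD -!fP /= /c actM chi1M chi3M.
  have -> : act g (act h (T i j)) = act g (T (i + chi1 h) (j + chi3 h) + mu (f h i j)).
    by congr (act g _); rewrite -fP /c; abelian_group.
  rewrite raddfD /= act_mu -fP /c [chi1 g + _]addrC [chi3 g + _]addrC !addrA; abelian_group.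
have f_near i j : locconst (fun g => f g i j).
  move=> g; near=> t; apply: mu_inj; rewrite -!fP /c.
  have -> : chi1 t = chi1 g by near: t; exact: chi1_near.
  have -> : chi3 t = chi3 g by near: t; exact: chi3_near.
  by congr (_ - _); near: t; exact: act_near.
exists (fun g => f g 0 0), f24, f13; split; split.
- exact: f_near.
- move=> g; near=> t; rewrite /f24; congr (_ - _); near: t; exact: f_near.
- move=> g; near=> t; rewrite /f13; congr (_ - _); near: t; exact: f_near.
- by move=> g h; rewrite {1}/f24 !fM (fE g) (fE g (0 + _)) (fE h 1); ring.
- by move=> g h; rewrite {1}/f13 !fM (fE g) (fE g (0 + _)) (fE h 0 1); ring.
- by move=> g h; rewrite fM (fE g (0 + _)); ring.
Unshelve. all: by end_near. Qed.

End Lift.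

(** Only the characters [a12], [a23] and [a34] of the given defining system are retained; [a13] and
    [a24] serve to know that the cup products of neighbours vanish, and are replaced. *)
Lemma triple_massey_vanishing (x1 x2 x3 : cohomology G p 1) :
  massey_product [tuple x1; x2; x3] !=set0 -> massey_product [tuple x1; x2; x3] 0.
Proof.
move=> [m [a [arep asys] _]].
have rep12 := arep (@Ordinal 3 0 isT); have rep23 := arep (@Ordinal 3 1 isT).
have rep34 := arep (@Ordinal 3 2 isT).
have chi1M := cocycle1_morph (differential_represented rep12).
have chi2M := cocycle1_morph (differential_represented rep23).
have chi3M := cocycle1_morph (differential_represented rep34).
rewrite /= in chi1M chi2M chi3M.
have d13 := asys 1%N 3%N isT isT isT isT.
have d24 := asys 2%N 4%N isT isT isT isT.
rewrite big_nat1 in d13; rewrite big_nat1 in d24.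
have [chi1_near chi2_near chi3_near] := And3
  (@cochain1_locconst G p (a 1%N 2%N)) (@cochain1_locconst G p (a 2%N 3%N))
  (@cochain1_locconst G p (a 3%N 4%N)).
set chi1 := fun g => a 1%N 2%N (const1 g) in chi1M chi1_near.
set chi2 := fun g => a 2%N 3%N (const1 g) in chi2M chi2_near.
set chi3 := fun g => a 3%N 4%N (const1 g) in chi3M chi3_near.
have cupE (F H : cochain G p 1) g h : cup F H (pair2 g h) = F (const1 g) * H (const1 h).
  by rewrite cup11E.
(* The product chi1 * chi2 bounds, up to sign, the sum of the cup products of chi1 and chi2
   in both orders; adding it exchanges the factors. *)
pose e1 g := a 1%N 3%N (const1 g) + chi1 g * chi2 g; pose e3 g := - a 2%N 4%N (const1 g).
have e1M g h : e1 (g * h)%g = e1 g + e1 h + chi2 g * chi1 h.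
  by rewrite /e1 (iffLR (differential1P _ _) d13) cupE chi1M chi2M -/(chi1 g) -/(chi2 h); ring.
have e3M g h : e3 (g * h)%g = e3 g + e3 h + chi2 g * chi3 h.
  by rewrite /e3 (iffLR (differential1P _ _) d24) cupE -/(chi2 g) -/(chi3 h); ring.
have e1_near : locconst e1.
  move=> g; near=> t; rewrite /e1; congr (_ + _ * _).
  - by near: t; exact: cochain1_locconst.
  - by near: t; exact: chi1_near.
  - by near: t; exact: chi2_near.
have e3_near : locconst e3.
  by move=> g; near=> t; rewrite /e3; congr (- _); near: t; exact: cochain1_locconst.
have [f14 [f24 [f13 [[f14_near f24_near f13_near] [f24M f13M f14M]]]]] :=
  unipotent_lift chi1M chi2M chi3M chi1_near chi2_near chi3_near e1M e3M e1_near e3_near.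
have [|B13 B13E] := @cochain1_exists G p (fun g => f13 g - chi1 g * chi2 g).
  move=> g; near=> t; congr (_ - _ * _).
  - by near: t; exact: f13_near.
  - by near: t; exact: chi1_near.
  - by near: t; exact: chi2_near.
have [|B24 B24E] := @cochain1_exists G p (fun g => - f24 g).
  by move=> g; near=> t; congr (- _); near: t; exact: f24_near.
have [|B14 B14E] := @cochain1_exists G p (fun g => chi1 g * f24 g - f14 g).
  move=> g; near=> t; congr (_ * _ - _).
  - by near: t; exact: chi1_near.
  - by near: t; exact: f24_near.
  - by near: t; exact: f14_near.
pose a' i j := if (i, j) == (1, 3)%N then B13 else if (i, j) == (2, 4)%N then B24 else a i j.
have a'sys : defining_system [tuple x1; x2; x3] a'.
  split=> [i|i j i1 ij j4 ij14].
    by have := arep i; case: i => -[|[|[|//]]].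
  have [[-> ->]|[-> ->]] : (i = 1 /\ j = 3)%N \/ (i = 2 /\ j = 4)%N.
    case: i j i1 ij j4 ij14 => [|[|[|i]]] [|[|[|[|[|j]]]]] //; by [left|right].
  - rewrite big_nat1 /a' /=; apply/differential1P => g h.
    by rewrite !B13E cupE f13M chi1M chi2M -/(chi1 g) -/(chi2 h); ring.
  - rewrite big_nat1 /a' /=; apply/differential1P => g h.
    by rewrite !B24E cupE f24M -/(chi2 g) -/(chi3 h); ring.
(* B14 is the missing corner entry: its differential is the Massey cochain. *)
exists a' => //; apply/represents0; split; first exact: massey_cochain_cocycle a'sys.
exists B14; apply/esym/differential1P => g h.
have -> : massey_cochain 3 a' = cup (a 1 2)%N B24 + (cup B13 (a 3 4)%N : cochain G p 2).
  by rewrite /massey_cochain big_nat_recr // big_nat1.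
rewrite cochainD !cupE.
rewrite !B14E B24E B13E chi1M f24M f14M -/(chi1 g) -/(chi3 h); ring.
Unshelve. all: by end_near. Qed.

End KummerModule.

(** * Hilbert 90 for the absolute Galois group *)

(** The multiplicative group of a field is written additively, to be a module. *)
Section MultiplicativeGroup.
Variable L : fieldType.

Record mulgrp := MulGrp { mulgrp_val :> L; mulgrp_neq0 : mulgrp_val != 0 }.
HB.instance Definition _ := [isSub for mulgrp_val].
HB.instance Definition _ := [Choice of mulgrp by <:].

Definition mulgrp_one := MulGrp (oner_neq0 L).
Definition mulgrp_mul (x y : mulgrp) :=
  MulGrp (mulf_neq0 (mulgrp_neq0 x) (mulgrp_neq0 y)).
Definition mulgrp_inv (x : mulgrp) := MulGrp (invr_neq0 (mulgrp_neq0 x)).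

Fact mulgrp_mulA : associative mulgrp_mul.
Proof. by move=> x y z; apply/val_inj/mulrA. Qed.
Fact mulgrp_mulC : commutative mulgrp_mul.
Proof. by move=> x y; apply/val_inj/mulrC. Qed.
Fact mulgrp_mul1 : left_id mulgrp_one mulgrp_mul.
Proof. by move=> x; apply/val_inj/mul1r. Qed.
Fact mulgrp_mulV : left_inverse mulgrp_one mulgrp_inv mulgrp_mul.
Proof. by move=> x; apply/val_inj/mulVf/mulgrp_neq0. Qed.
HB.instance Definition _ :=
  GRing.isZmodule.Build mulgrp mulgrp_mulA mulgrp_mulC mulgrp_mul1 mulgrp_mulV.

Lemma mulgrp_valD (x y : mulgrp) : (x + y : mulgrp) = mulgrp_val x * mulgrp_val y :> L.
Proof. by []. Qed.
Lemma mulgrp_valMn (x : mulgrp) n : (x *+ n : mulgrp) = mulgrp_val x ^+ n :> L.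
Proof. by elim: n => [|n IH]; rewrite ?expr0 // mulrS exprS mulgrp_valD IH. Qed.

End MultiplicativeGroup.

(** Dedekind's independence of characters, for characters of a submonoid [M] of the field: the
    automorphisms in use below are distinct only on a finite extension. If [i] is the first
    index, replacing [x] by [x * y] and subtracting [f i y] times the relation removes [i]. *)
Lemma dedekind_independence (L : fieldType) (I : eqType) (f : I -> L -> L)
    (M : L -> Prop) (r : seq I) (c : I -> L) :
    M 1 -> (forall x y, M x -> M y -> M (x * y)) -> (forall i, f i 1 = 1) ->
    (forall i x y, f i (x * y) = f i x * f i y) ->
    uniq r -> {in r &, forall i j, (forall x, M x -> f i x = f j x) -> i = j} ->
    (forall x, M x -> \sum_(i <- r) c i * f i x = 0) ->
  {in r, forall i, c i = 0}.
Proof.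
move=> M1 MM f1 fM; elim: r c => [//|i r IH] c /=/andP[ir ur] fI c0.
have cr : {in r, forall j, c j = 0}.
  move=> j jr; apply/eqP/negP => /negP cj.
  suff ij : i = j by rewrite ij jr in ir.
  apply: (fI); rewrite ?inE ?eqxx ?jr ?orbT // => y My; apply/esym/eqP.
  rewrite -subr_eq0 -(mulrI_eq0 _ (mulfI cj)); apply/eqP.
  apply: (IH (fun k => c k * (f k y - f i y))) => // [k l kr lr|x Mx].
    by apply: fI; rewrite inE ?kr ?lr orbT.
  transitivity (\sum_(k <- i :: r) c k * f k (x * y)
                - f i y * \sum_(k <- i :: r) c k * f k x).
    rewrite !big_cons fM mulrDr opprD addrACA.
    rewrite (_ : c i * (f i x * f i y) - f i y * (c i * f i x) = 0); last by ring.
    by rewrite add0r mulr_sumr -sumrB; apply: eq_bigr => k _; rewrite fM; ring.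
  by rewrite !c0 ?mulr0 ?subr0 //; exact: MM.
move=> j; rewrite inE => /predU1P[->|/cr//].
have := c0 1 M1; rewrite big_cons f1 mulr1 big_seq big1 ?addr0 // => k /cr->.
by rewrite mul0r.
Qed.

Lemma finitely_many_roots (L : fieldType) (q : {poly L}) :
  q != 0 -> exists s : seq L, forall x, root q x -> x \in s.
Proof.
have [n] := ubnP (size q); elim: n q => [//|n IH] q szq q0.
have [[x]|noroot] := pselect (exists x, root q x); last first.
  by exists [::] => x xq; case: noroot; exists x.
move=> /factor_theorem[q' qE]; have q'0 : q' != 0.
  by apply: contra_neq q0 => q'0; rewrite qE q'0 mul0r.
have [|s sP] := IH q' _ q'0.
  by move: szq; rewrite qE size_Mmonic ?monicXsubC // size_XsubC addn2.
exists (x :: s) => y; rewrite qE rootM root_XsubC inE => /orP[/sP->|->//].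
by rewrite orbT.
Qed.

Section AbsoluteGaloisModule.
Variables (K L : fieldType) (iota : {rmorphism K -> L}).
Local Notation G := (absgal iota).

Lemma absgal_mulE (s t : G) x : (s * t)%g x = s (t x). Proof. by []. Qed.

Fact absgal_act_neq0 (s : G) (x : mulgrp L) : s x != 0.
Proof. by rewrite fmorph_eq0 mulgrp_neq0. Qed.
Definition absgal_act (s : G) (x : mulgrp L) := MulGrp (absgal_act_neq0 s x).
Fact absgal_act_is_zmod_morphism s : zmod_morphism (absgal_act s).
Proof. by move=> x y; apply: val_inj; rewrite /= rmorphM fmorphV. Qed.
HB.instance Definition _ s := GRing.isZmodMorphism.Build _ _
  (absgal_act s) (absgal_act_is_zmod_morphism s).

Hypothesis algL : forall x : L,
  exists2 q : {poly K}, separable_poly q & root (map_poly iota q) x.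

(** The conjugates of an element are among the roots of a polynomial over the base field. *)
Lemma absgal_finite_stable (E : seq L) : exists2 S : seq L,
  {subset E <= S} & forall (s : G) x, x \in S -> s x \in S.
Proof.
elim: E => [|x E [S ES Sst]]; first by exists [::].
have [q qsep qx] := algL x.
have [|r rP] := @finitely_many_roots L (map_poly iota q).
  by rewrite map_poly_eq0 separable_poly_neq0.
exists ([seq y <- r | root (map_poly iota q) y] ++ S) => [y|s y].
  rewrite inE mem_cat mem_filter => /predU1P[->|/ES->]; last by rewrite orbT.
  by rewrite qx rP.
rewrite !mem_cat !mem_filter => /orP[/andP[qy _]|/Sst->]; last by rewrite orbT.
suff qsy : root (map_poly iota q) (s y) by rewrite qsy rP.
rewrite -[map_poly iota q](_ : map_poly s (map_poly iota q) = _).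
  by rewrite fmorph_root.
by rewrite -map_poly_comp; apply: eq_map_poly => k /=; rewrite absgal_fix.
Qed.

Variable p : nat.
Hypothesis p_pr : prime p.
Variables (chi : G -> 'F_p) (c : G -> 'F_p -> mulgrp L).
Hypothesis chiM : {morph chi : g h / (g * h)%g >-> g + h}.
Hypothesis cM : forall g h i, c (g * h)%g i = absgal_act g (c h i) + c g (i + chi h).

(** The i-th solution [w i] is only known to be nonzero at [i]. If [chi] is nontrivial, it
    translates [0] everywhere, and [w 0] has no zeros; otherwise the points do not interact, and
    values of different solutions can be combined. *)
Lemma semilinear_of_one (w : 'F_p -> 'F_p -> L) :
    (forall i g j, w i (j + chi g) = (c g j : L) * g (w i j)) ->
    (forall i, w i i != 0) ->
  exists2 v : 'F_p -> L, forall g j, v (j + chi g) = (c g j : L) * g (v j) &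
    forall i, v i != 0.
Proof.
move=> wM w0; have [[g g0]|chi0] := pselect (exists g, chi g != 0); last first.
  have {}chi0 g : chi g = 0 by apply/eqP/negP => /negP g0; apply: chi0; exists g.
  by exists (fun i => w i i) => // g j; rewrite chi0 addr0 -wM chi0 addr0.
exists (w 0) => // i; rewrite -[i](divfK g0); move: (i / chi g) => {i}.
apply: Fp_ind => [|i wi]; first by rewrite mul0r.
by rewrite mulrDl mul1r wM mulf_neq0 ?fmorph_eq0 ?mulgrp_neq0.
Qed.

(** The Poincare series [v x] averages the cocycle over a finite Galois quotient, realised as
    the restrictions of automorphisms to a finite stable set [S], large enough to determine
    [chi] and [c]. Here [x] ranges over the field [M] fixed by the automorphisms that fix [S],
    and by independence of characters some [x] makes the series nonzero at a given point. *)
Lemma hilbert90_absgal :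
  (\forall t \near (1%g : G), chi t = 0 /\ forall i, c t i = 0) ->
  exists phi, forall g i, c g i = absgal_act g (phi i) - phi (i + chi g).
Proof.
move=> /krull_nbhsP[E EP]; have [S ES Sst] := absgal_finite_stable E.
have {EP} SP (t : G) : {in S, forall x, t x = x} -> chi t = 0 /\ forall i, c t i = 0.
  by move=> tS; apply: EP => x /ES/tS.
pose M x := forall t : G, {in S, forall x, t x = x} -> t x = x.
have SM x : x \in S -> M x by move=> xS t; apply.
have agree (g h : G) : {in S, g =1 h} ->
    [/\ chi g = chi h, forall i, c g i = c h i & forall x, M x -> g x = h x].
  move=> gh; pose t := (g^-1 * h)%g; have hE : h = (g * t)%g by rewrite mulgA mulgV mul1g.
  have tS : {in S, forall x, t x = x}.
    by move=> x xS; rewrite absgal_mulE -gh //; exact: absgal_invK.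
  have [t0 ct] := SP t tS; split=> [|i|x Mx]; rewrite hE.
  - by rewrite chiM t0 addr0.
  - by rewrite cM ct raddf0 add0r t0 addr0.
  - by rewrite absgal_mulE (Mx t).
pose T := {ffun seq_sub S -> seq_sub S}.
pose res (g : G) : T := [ffun u => SeqSub (Sst g _ (valP u))].
have resE g h : res g = res h <-> {in S, g =1 h}.
  split=> [rgh x xS|gh].
    by have := congr1 (fun f : T => val (f (SeqSub xS))) rgh; rewrite !ffunE.
  by apply/ffunP => u; rewrite !ffunE; apply: val_inj; exact/gh/valP.
have [rep repP] : {rep : T -> G | forall g, res (rep (res g)) = res g}.
  have /choice[rep repP] : forall s : T, exists g, (exists h, res h = s) -> res g = s.
    by move=> s; have [[g <-]|nog] := pselect (exists h, res h = s); [exists g|exists 1%g].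
  by exists rep => g; apply: repP; exists g.
pose P (s : T) := `[< exists g, s = res g >].
have PE s : P s -> res (rep s) = s by move=> /asboolP[g ->].
(* Left translation by g on restrictions, used to reindex the series. *)
pose tr g (s : T) : T := [ffun u => res g (s u)].
have trE g h : tr g (res h) = res (g * h)%g.
  by apply/ffunP => u; rewrite !ffunE; exact: val_inj.
have trI g : injective (tr g).
  move=> s t st; apply/ffunP => u; apply/val_inj/(fmorph_inj g).
  by have := congr1 (fun f : T => val (f u)) st; rewrite !ffunE.
have trP g s : P (tr g s) = P s.
  apply/asboolP/asboolP => [[h hE]|[h ->]]; last by exists (g * h)%g; rewrite trE.
  by exists (g^-1 * h)%g; apply: (trI g); rewrite trE mulgA mulgV mul1g.
pose v (x : L) (j : 'F_p) := \sum_(s | P s) (c (rep s) (j - chi (rep s)) : L) * rep s x.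
have vM x : M x -> forall g j, v x (j + chi g) = (c g j : L) * g (v x j).
  move=> Mx g j; rewrite /v (reindex_inj (trI g)) rmorph_sum mulr_sumr.
  apply: eq_big => [s|s Pgs]; first exact: trP.
  have Ps : P s by rewrite -(trP g).
  have /resE/agree[chiE cE xE] : res (rep (tr g s)) = res (g * rep s)%g.
    by rewrite PE // -trE PE.
  rewrite chiE cE xE // rmorphM mulrA; congr (_ * _).
  rewrite cM chiM mulgrp_valD /= mulrC; congr (mulgrp_val (c g _) * g (mulgrp_val (c _ _))).
    by ring.
  by ring.
have v0 i : exists2 x, M x & v x i != 0.
  have [//|v0] := pselect (exists2 x, M x & v x i != 0).
  suff /(_ (res 1%g)) : {in enum P, forall s, (c (rep s) (i - chi (rep s)) : L) = 0}.
    rewrite mem_enum => /(_ (asboolT _)) c0.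
    have := mulgrp_neq0 (c (rep (res 1%g)) (i - chi (rep (res 1%g)))).
    by rewrite c0 ?eqxx //; exists 1%g.
  apply: (@dedekind_independence L T (fun s => rep s) M) => [||s|s x y||s t|x Mx].
  - by move=> t _; exact: rmorph1.
  - by move=> x y Mx My t tS; rewrite rmorphM /= (Mx t tS) (My t tS).
  - exact: rmorph1.
  - exact: rmorphM.
  - exact: enum_uniq.
  - rewrite !mem_enum => Ps Pt st; rewrite -(PE s) // -(PE t) //.
    by apply/resE => x /SM/st.
  - rewrite big_enum; apply/eqP/negP => /negP vx; apply: v0; by exists x.
have /choice[x xP] : forall i, exists x, M x /\ v x i != 0.
  by move=> i; have [x] := v0 i; exists x.
have [||w wM w0] := @semilinear_of_one (fun i => v (x i)).
- by move=> i; apply: vM; case: (xP i).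
- by move=> i; case: (xP i).
exists (fun i => - MulGrp (w0 i)) => g i; apply: val_inj.
rewrite raddfN opprK addrC /= wM mulfK // fmorph_eq0; exact: w0.
Qed.

End AbsoluteGaloisModule.

(** * Absolute Galois groups of fields with a p-th root of unity *)

Section RootsOfUnity.
Variables (p : nat) (K L : fieldType) (iota : {rmorphism K -> L}) (zeta : K).
Hypotheses (p_pr : prime p) (sepL : separable_closure iota).
Hypothesis (zeta_prim : p.-primitive_root zeta).
Local Notation G := (absgal iota).

Let z_prim : p.-primitive_root (iota zeta).
Proof. by rewrite fmorph_primitive_root. Qed.

Fact zeta_pow_neq0 (k : 'F_p) : iota zeta ^+ k != 0.
Proof.
apply/expf_neq0/eqP => z0; have /eqP := prim_expr_order z_prim.
by rewrite z0 expr0n gtn_eqF ?prime_gt0 // eq_sym oner_eq0.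
Qed.
Definition zeta_pow (k : 'F_p) := MulGrp (zeta_pow_neq0 k).

Lemma zeta_pow_is_zmod_morphism : zmod_morphism zeta_pow.
Proof.
have zD k l : zeta_pow (k + l) = zeta_pow k + zeta_pow l.
  by apply: val_inj; exact: zeta_FpD p_pr zeta_prim k l.
by move=> k l; rewrite -[k in RHS](subrK l) [in RHS]zD addrK.
Qed.

Lemma mulgrp_divisible (x : mulgrp L) : exists y : mulgrp L, y *+ p = x.
Proof.
(* L is its own separable closure, so every element of L has a p-th root. *)
have sepLL : separable_closure (idfun : {rmorphism L -> L}).
  split=> [x0|]; last exact: sepL.2.
  exists ('X - x0%:P); last by rewrite map_poly_id // root_XsubC.
  by rewrite unlock derivXsubC coprimep1.
have [y yE] := kummer_root_exists p_pr sepLL z_prim (mulgrp_neq0 x).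
have y0 : y != 0.
  by apply: contra_neq (mulgrp_neq0 x) => y0; rewrite -[LHS]yE y0 expr0n gtn_eqF ?prime_gt0.
by exists (MulGrp y0); apply: val_inj; rewrite -[RHS]yE; exact: mulgrp_valMn.
Qed.

Lemma triple_massey_absgal (x1 x2 x3 : cohomology G p 1) :
  massey_product [tuple x1; x2; x3] !=set0 -> massey_product [tuple x1; x2; x3] 0.
Proof.
pose zm := GRing.isZmodMorphism.Build _ _ zeta_pow zeta_pow_is_zmod_morphism.
pose mu : {additive 'F_p -> mulgrp L} := HB.pack zeta_pow zm.
apply: (@triple_massey_vanishing G p (mulgrp L) (@absgal_act _ _ iota) mu p_pr).
- by move=> v; exact: val_inj.
- by move=> g h v; exact: val_inj.
- move=> g v; apply/krull_nbhsP; exists [:: val v] => t tv.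
  by apply: val_inj; exact/tv/mem_head.
- by move=> g k; apply: val_inj; rewrite /= rmorphXn /= absgal_fix.
- by move=> k l /(congr1 val)/(zeta_Fp_inj p_pr zeta_prim).
- move=> v /(congr1 val); rewrite /= mulgrp_valMn => /(prim_rootP z_prim)[i iE].
  exists i%:R; apply: val_inj.
  by rewrite /= iE val_Fp_nat // (prim_expr_mod z_prim).
- exact: mulgrp_divisible.
- move=> chi c chiM cM; apply: hilbert90_absgal => //; exact: sepL.1.
Qed.

End RootsOfUnity.

Theorem theorem1p3 (p : nat) (K : fieldType) (zeta : K)
    (Ksep : fieldType) (iota : {rmorphism K -> Ksep}) (a b c : K) :
  prime p -> global_field K -> p.-primitive_root zeta ->
  separable_closure iota ->
  a != 0 -> b != 0 -> c != 0 ->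
  let chi : K -> cohomology (absgal iota) p 1 := kummer_char p iota zeta in
  let M : set (cohomology (absgal iota) p 2) :=
    massey_product [tuple chi a; chi b; chi c] in
  M !=set0 -> M 0.
Proof.
move=> p_pr _ zeta_prim sepL _ _ _ chi M.
exact: (triple_massey_absgal p_pr sepL zeta_prim (x1 := chi a)).
Qed.
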